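(* For all integers $n$, $m$, $r$, $s$, we have $$V_{n}V_{m}=V_{n+r}V_{m-r}+q^{n}\Delta U_{r}U_{m-n-r}=\Delta U_{n+s}U_{m-s}+q^{m-s}V_{s}V_{n-m+s}.$$
   Context: Let $p,q$ be integers with $p\neq 0$, $q\in\{1,-1\}$, and $\Delta:=p^2-4q\neq 0$. The sequences $(U_n)_{n\in\mathbb{Z}}$ and $(V_n)_{n\in\mathbb{Z}}$ are defined by $U_0=0$, $U_1=1$, $V_0=2$, $V_1=p$ and the recurrences $U_n=pU_{n-1}-qU_{n-2}$, $V_n=pV_{n-1}-qV_{n-2}$ for all $n\in\mathbb{Z}$ (so they are extended to negative indices by the recurrence). *)

(* Defs.v *)
From HB Require Import structures.
From mathcomp Require Import all_boot all_order all_algebra zify ring.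

Set Implicit Arguments.
Unset Strict Implicit.
Unset Printing Implicit Defensive.

Import Order.TTheory GRing.Theory Num.Theory.

Local Open Scope ring_scope.

(* The recurrence ranges over all of int.  When q is 1 or -1 it can be solved
   for W (n - 2), so the two initial values determine W at negative indices. *)
Definition lucas_recurrence (p q a b : int) (W : int -> int) : Prop :=
  [/\ W 0 = a, W 1 = b & forall n : int, W n = p * W (n - 1) - q * W (n - 2)].

Definition lucasU (p q : int) : (int -> int) -> Prop := lucas_recurrence p q 0 1.

Definition lucasV (p q : int) : (int -> int) -> Prop := lucas_recurrence p q 2 p.

Definition discriminant (p q : int) : int := p ^+ 2 - 4 * q.

Lemma lucas_recurrence_exists (p q a b : int) :
  q = 1 \/ q = -1 -> exists W : int -> int, lucas_recurrence p q a b W.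
Proof.
move=> hq; have qq : q * q = 1 by case: hq => ->.
pose fwd (x : int * int) := (x.2, p * x.2 - q * x.1).
pose bwd (x : int * int) := (q * (p * x.1 - x.2), x.1).
have bK x : fwd (bwd x) = x.
  by case: x => x y; rewrite /fwd /bwd /= mulrA qq mul1r opprB addrC subrK.
pose S (n : int) :=
  match n with Posz k => iter k fwd (a, b) | Negz k => iter k.+1 bwd (a, b) end.
have S1 n : S (n + 1) = fwd (S n).
  case: n => [k|[|k]]; first by rewrite -PoszD addn1.
    by rewrite /= bK.
  have -> : Negz k.+1 + 1 = Negz k by lia.
  by rewrite [S (Negz k.+1)]iterS bK.
exists (fun n => (S n).1); split=> // n.
have e1 : n - 1 = n - 2 + 1 by ring.
have e2 : n = n - 2 + 1 + 1 by ring.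
by rewrite {1}e2 e1 !S1.
Qed.

Lemma lucas_recurrence_unique (p q a b : int) (W W' : int -> int) :
  q = 1 \/ q = -1 -> lucas_recurrence p q a b W ->
  lucas_recurrence p q a b W' -> W =1 W'.
Proof.
move=> hq [W0 W1 Wr] [W'0 W'1 W'r].
have q0 : q != 0 by case: hq => ->.
have up (k : nat) : W k = W' k /\ W (k%:Z + 1) = W' (k%:Z + 1).
  elim: k => [|k [e1 e2]]; first by rewrite add0r W0 W'0 W1 W'1.
  have -> : k.+1%:Z = k%:Z + 1 by lia.
  split=> //; rewrite Wr W'r addrK e2.
  have -> : k%:Z + 1 + 1 - 2 = k%:Z by ring.
  by rewrite e1.
have dn (k : nat) : W (- k%:Z) = W' (- k%:Z) /\ W (1 - k%:Z) = W' (1 - k%:Z).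
  elim: k => [|k [e1 e2]]; first by rewrite oppr0 addr0 W0 W'0 W1 W'1.
  have e3 : 1 - k.+1%:Z = - k%:Z by lia.
  rewrite e3; split=> //.
  have e4 : 1 - k%:Z - 1 = - k%:Z by lia.
  have e5 : 1 - k%:Z - 2 = - k.+1%:Z by lia.
  move: (Wr (1 - k%:Z)) (W'r (1 - k%:Z)); rewrite e4 e5 e1 e2 => -> /addrI.
  by move/oppr_inj/(mulfI q0).
by case=> k; [case: (up k) | rewrite NegzE; case: (dn k.+1)].
Qed.

(* Main.v *)
Require Import Defs.
From mathcomp Require Import all_boot all_order all_algebra.
From mathcomp Require Import ring.

(** Write [V n = x ^ n + y ^ n] and [U n = (x ^ n - y ^ n) / (x - y)] with
    [x + y = p], [x * y = q] and [(x - y) ^ 2 = p ^ 2 - 4 q].  Multiplying out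
    gives two product-to-sum formulas, [lucasV_mulV] and [lucasU_mulU]:

      V n * V m               = V (n + m) + q ^ n * V (m - n),
      (p ^ 2 - 4 q) * U n * U m = V (n + m) - q ^ n * V (m - n).

    Each product in the theorem expands by one of them.  All three members
    then reduce to [V (n + m) + q ^ n * V (m - n)]: in the second and the third
    the two extra terms cancel, and the third needs in addition the reflection
    [q ^ n * V (- n) = V n] ([lucasV_reflect]) to turn [V (n - m)] into
    [V (m - n)].

    The roots [x] and [y] never appear in the proofs below.  Solutions of the
    recurrence are stable under shifts and linear combinations, and a solution
    is determined by its values at 0 and 1; so every formula is checked at
    those two indices only. *)

Import Order.TTheory GRing.Theory Num.Theory.

Local Open Scope ring_scope.

Lemma pm1_unit {q : int} : q = 1 \/ q = -1 -> q \is a GRing.unit.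
Proof. by case=> ->. Qed.

Lemma pm1_sqr {q : int} : q = 1 \/ q = -1 -> q * q = 1.
Proof. by case=> ->. Qed.

(** As [q] is its own inverse, so is each of its powers. *)
Lemma pm1_exprB {q : int} (n k : int) :
  q = 1 \/ q = -1 -> q ^ (n - k) = q ^ n * q ^ k.
Proof.
move=> hq; rewrite exprzDr ?pm1_unit // -exprz_inv.
by case: hq => ->; rewrite ?invrN invr1.
Qed.

Lemma pm1_expr_sqr {q : int} (n : int) : q = 1 \/ q = -1 -> q ^ n * q ^ n = 1.
Proof. by move=> hq; rewrite -pm1_exprB // subrr expr0z. Qed.

Lemma lucas_recurrence_shift {p q a b : int} {W : int -> int} (k : int) :
  lucas_recurrence p q a b W ->
  lucas_recurrence p q (W k) (W (k + 1)) (fun n => W (k + n)).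
Proof.
case=> _ _ Wr; split=> [|//|n]; first by rewrite addr0.
by rewrite [LHS]Wr !addrA.
Qed.

Lemma lucas_recurrence_comb {p q a b a' b' : int} {W W' : int -> int}
    (c d : int) :
  lucas_recurrence p q a b W -> lucas_recurrence p q a' b' W' ->
  lucas_recurrence p q (c * a + d * a') (c * b + d * b')
    (fun n => c * W n + d * W' n).
Proof.
case=> W0 W1 Wr [W'0 W'1 W'r]; split=> [||n]; rewrite ?W0 ?W1 ?W'0 ?W'1 //.
by rewrite Wr W'r; ring.
Qed.

Lemma lucas_recurrence_scale {p q a b : int} {W : int -> int} (c : int) :
  lucas_recurrence p q a b W ->
  lucas_recurrence p q (c * a) (c * b) (fun n => c * W n).
Proof.
by case=> W0 W1 Wr; split=> [||n]; rewrite ?W0 ?W1 // Wr; ring.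
Qed.

Lemma lucas_recurrence_next {p q a b : int} {W : int -> int} (n : int) :
  lucas_recurrence p q a b W -> W (n + 1) = p * W n - q * W (n - 1).
Proof.
case=> _ _ Wr; rewrite Wr addrK.
by have -> : n + 1 - 2 = n - 1 by ring.
Qed.

(** With [x * y = q], the reflected term [q ^ n * x ^ (- n)] is [y ^ n]: the
    reflection exchanges the roots, and [V] is symmetric in them. *)
Lemma lucasV_reflect {p q : int} {V : int -> int}
    (hq : q = 1 \/ q = -1) (hV : lucasV p q V) (n : int) :
  q ^ n * V (- n) = V n.
Proof.
have [V0 V1 _] := hV.
apply: (@lucas_recurrence_unique p q 2 p (fun k => q ^ k * V (- k))) => //.
split=> [||k]; first by rewrite expr0z oppr0 V0 mul1r.
  have := lucas_recurrence_next 0 hV; rewrite !add0r V0 V1 expr1z => e.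
  have -> : q * V (- 1) = p * 2 - (p * 2 - q * V (- 1)) by ring.
  by rewrite -e; ring.
have := lucas_recurrence_next (- (k - 1)) hV.
have -> : - (k - 1) + 1 = - (k - 2) by ring.
have -> : - (k - 1) - 1 = - k by ring.
move=> ->; rewrite !pm1_exprB // expr1z.
rewrite (_ : q ^ 2 = 1); last by rewrite -exprnP expr2 pm1_sqr.
transitivity (q ^ k * (q * q) * V (- k)); last by ring.
by rewrite pm1_sqr // mulr1.
Qed.

Lemma lucasV_reflect_sub {p q : int} {V : int -> int}
    (hq : q = 1 \/ q = -1) (hV : lucasV p q V) (n m : int) :
  q ^ n * V (m - n) = q ^ m * V (n - m).
Proof.
rewrite -[V (n - m)](lucasV_reflect hq hV) opprB pm1_exprB //.
transitivity (q ^ m * q ^ m * (q ^ n * V (m - n))); last by ring.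
by rewrite pm1_expr_sqr // mul1r.
Qed.

Lemma lucasV_reflect_pred {p q : int} {V : int -> int}
    (hq : q = 1 \/ q = -1) (hV : lucasV p q V) (n : int) :
  q ^ n * V (1 - n) = q * V (n - 1).
Proof. by rewrite (lucasV_reflect_sub hq hV) expr1z. Qed.

(** For fixed [n] both sides solve the recurrence in [m]; the reflection gives
    the value at 0, and turns the value at 1 into the recurrence itself. *)
Lemma lucasV_mulV {p q : int} {V : int -> int}
    (hq : q = 1 \/ q = -1) (hV : lucasV p q V) (n m : int) :
  V n * V m = V (n + m) + q ^ n * V (m - n).
Proof.
have := lucas_recurrence_comb 1 (q ^ n) (lucas_recurrence_shift n hV)
          (lucas_recurrence_shift (- n) hV).
have e0 : 1 * V n + q ^ n * V (- n) = V n * 2.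
  by rewrite (lucasV_reflect hq hV); ring.
have e1 : 1 * V (n + 1) + q ^ n * V (- n + 1) = V n * p.
  rewrite [- n + 1]addrC (lucasV_reflect_pred hq hV).
  by rewrite (lucas_recurrence_next n hV); ring.
rewrite e0 e1 => /(lucas_recurrence_unique hq (lucas_recurrence_scale (V n) hV)).
by move=> /(_ m) ->; rewrite mul1r [- n + m]addrC.
Qed.

(** The initial value at [m = 1] in [lucasU_mulU].  The right-hand side, a
    combination of shifts of [V], solves the recurrence in [n]; it vanishes at
    0 by reflection and is [V 2 - 2 q = p ^ 2 - 4 q] at 1. *)
Lemma discriminant_mulU {p q : int} {U V : int -> int}
    (hq : q = 1 \/ q = -1) (hU : lucasU p q U) (hV : lucasV p q V) (n : int) :
  discriminant p q * U n = V (n + 1) - q * V (n - 1).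
Proof.
have [V0 V1 _] := hV.
have := lucas_recurrence_comb 1 (- q) (lucas_recurrence_shift 1 hV)
          (lucas_recurrence_shift (- 1) hV).
have e2 := lucas_recurrence_next 1 hV; rewrite subrr V0 V1 in e2.
have em : q * V (- 1) = p.
  by rewrite -V1 -[V 1](lucasV_reflect hq hV) expr1z.
have e0 : 1 * V 1 + - q * V (- 1) = discriminant p q * 0.
  by rewrite mulNr em V1; ring.
have e1 : 1 * V (1 + 1) + - q * V (- 1 + 1) = discriminant p q * 1.
  by rewrite e2 addNr V0 /discriminant; ring.
rewrite e0 e1.
move/(lucas_recurrence_unique hq (lucas_recurrence_scale _ hU))/(_ n) => ->.
by rewrite mul1r mulNr [1 + n]addrC [- 1 + n]addrC.
Qed.

(** As for [lucasV_mulV], with the sign making the value at [m = 0] vanish. *)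
Lemma lucasU_mulU {p q : int} {U V : int -> int}
    (hq : q = 1 \/ q = -1) (hU : lucasU p q U) (hV : lucasV p q V) (n m : int) :
  discriminant p q * U n * U m = V (n + m) - q ^ n * V (m - n).
Proof.
have := lucas_recurrence_comb 1 (- q ^ n) (lucas_recurrence_shift n hV)
          (lucas_recurrence_shift (- n) hV).
have e0 : 1 * V n + - q ^ n * V (- n) = discriminant p q * U n * 0.
  by rewrite mulNr (lucasV_reflect hq hV); ring.
have e1 : 1 * V (n + 1) + - q ^ n * V (- n + 1) = discriminant p q * U n * 1.
  rewrite mulNr [- n + 1]addrC (lucasV_reflect_pred hq hV).
  by rewrite (discriminant_mulU hq hU hV); ring.
rewrite e0 e1.
move/(lucas_recurrence_unique hq (lucas_recurrence_scale _ hU))/(_ m) => ->.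
by rewrite mul1r mulNr [- n + m]addrC.
Qed.

Theorem theorem8 (p q : int) (U V : int -> int)
  (hp : p <> 0) (hq : q = 1 \/ q = -1) (hD : discriminant p q <> 0)
  (hU : lucasU p q U) (hV : lucasV p q V) (n m r s : int) :
  V n * V m = V (n + r) * V (m - r)
              + q ^ n * discriminant p q * U r * U (m - n - r)
  /\
  V (n + r) * V (m - r) + q ^ n * discriminant p q * U r * U (m - n - r)
  = discriminant p q * U (n + s) * U (m - s)
    + q ^ (m - s) * V s * V (n - m + s).
Proof.
have mulV := lucasV_mulV hq hV; have mulU := lucasU_mulU hq hU hV.
have first_eq : V n * V m = V (n + r) * V (m - r)
    + q ^ n * discriminant p q * U r * U (m - n - r).
  rewrite -[q ^ n * _ * _ * _]mulrA -[q ^ n * _ * _]mulrA.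
  rewrite [discriminant p q * _]mulrA.
  rewrite !mulV mulU exprzDr ?pm1_unit //.
  have -> : n + r + (m - r) = n + m by ring.
  have -> : r + (m - n - r) = m - n by ring.
  have -> : m - n - r - r = m - r - (n + r) by ring.
  by ring.
split=> //; rewrite -first_eq.
(* Swapping the two factors [U] makes [lucasU_mulU] produce the power
   [q ^ (m - s)], the same as in the last term. *)
rewrite -[q ^ (m - s) * _ * _]mulrA [discriminant p q * U (n + s) * _]mulrAC.
rewrite !mulV !mulU.
have -> : m - s + (n + s) = n + m by ring.
have -> : s + (n - m + s) = n + s - (m - s) by ring.
have -> : n - m + s - s = n - m by ring.
rewrite (lucasV_reflect_sub hq hV) pm1_exprB //.
transitivity (V (n + m) + q ^ s * q ^ s * (q ^ m * V (n - m))); last by ring.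
by rewrite pm1_expr_sqr // mul1r.
Qed.
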